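(* Let $R$ be a maximal subring of a ring $T$ such that $(R:T)$ is a maximal ideal of $T$. If $(R:T)\subsetneq (R:T)_l$ and $(R:T)\subsetneq (R:T)_r$ (i.e., $(R:T)_l$ and $(R:T)_r$ are not ideals of $T$), then the following hold: (1) ${}_RT$ and $T_R$ are finitely generated. (2) $(R:T)_l$ is a finitely generated right $R$-module which is a right primitive ideal of $R$. In particular, $\mathrm{l.ann}_T((R:T)_l)=\mathrm{l.ann}_T(p_1)\cap\cdots\cap \mathrm{l.ann}_T(p_m)$ for some $p_1,\ldots,p_m\in (R:T)_l$. (3) $(R:T)_r$ is a finitely generated left $R$-module which is a left primitive ideal of $R$. In particular, $\mathrm{r.ann}_T((R:T)_r)=\mathrm{r.ann}_T(q_1)\cap\cdots\cap \mathrm{r.ann}_T(q_n)$ for some $q_1,\ldots,q_n\in (R:T)_r$. In particular, if $(R:T)$ is a maximal ideal of $T$ which is not a prime ideal of $R$, then (1)–(3) hold.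
   Context: All rings are associative, unital with $1\neq 0$, and not necessarily commutative; subrings contain the identity of the overring; modules are unital. A subring $R\subsetneq T$ is a maximal subring of $T$ if there is no subring $S$ with $R\subsetneq S\subsetneq T$. $(R:T):=\{x\in T\mid TxT\subseteq R\}$, $(R:T)_l:=\{x\in T\mid Tx\subseteq R\}$ and $(R:T)_r:=\{x\in T\mid xT\subseteq R\}$ are respectively the largest two-sided, left and right ideal of $T$ contained in $R$; all are two-sided ideals of $R$. For a subset (or element) $X$ of $T$, $\mathrm{l.ann}_T(X)=\{t\in T\mid tX=0\}$ and $\mathrm{r.ann}_T(X)=\{t\in T\mid Xt=0\}$. A left (resp. right) primitive ideal is the annihilator of a simple left (resp. right) module. *)

(* Defs.v *)
From HB Require Import structures.
From mathcomp Require Import all_boot all_order all_algebra.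
From mathcomp Require Import boolp classical_sets.

Set Implicit Arguments.
Unset Strict Implicit.
Unset Printing Implicit Defensive.

Import GRing.Theory.
Local Open Scope classical_set_scope.
Local Open Scope ring_scope.

Section SubringType.
Variables (T : nzRingType) (R : subringClosed T).

Record subring : predArgType :=
  Subring { subring_val :> T; _ : subring_val \in R }.

HB.instance Definition _ := [isSub for subring_val].
HB.instance Definition _ := [Choice of subring by <:].
HB.instance Definition _ := [SubChoice_isSubNzRing of subring by <:].

End SubringType.

Definition maximal_subring (T : nzRingType) (R : subringClosed T) : Prop :=
  [set` R] `<` setT /\
  ~ (exists S : subringClosed T, [set` R] `<` [set` S] /\ [set` S] `<` setT).

Section Ideals.
Variable A : nzRingType.
Implicit Types I J P : set A.

Definition two_sided_ideal I : Prop :=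
  [/\ I 0, forall x y, I x -> I y -> I (x - y),
      forall a x, I x -> I (a * x) & forall a x, I x -> I (x * a)].

Definition maximal_ideal I : Prop :=
  [/\ two_sided_ideal I, I `<` setT &
      forall J, two_sided_ideal J -> I `<=` J -> J = I \/ J = setT].

(* The noncommutative notion: a condition on products of ideals, which is
   weaker than the elementwise "x * y in P implies x in P or y in P". *)
Definition prime_ideal P : Prop :=
  [/\ two_sided_ideal P, P `<` setT &
      forall I J, two_sided_ideal I -> two_sided_ideal J ->
        (forall x y, I x -> J y -> P (x * y)) -> I `<=` P \/ J `<=` P].

Definition lann (X : set A) : set A := [set t | forall x, X x -> t * x = 0].
Definition rann (X : set A) : set A := [set t | forall x, X x -> x * t = 0].

Definition simple_module (V : lmodType A) : Prop :=
  (exists v : V, v != 0) /\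
  forall W : submodClosed V, [set` W] = [set 0] \/ [set` W] = setT.

Definition left_primitive P : Prop :=
  exists V : lmodType A,
    simple_module V /\ P = [set a : A | forall v : V, a *: v = 0].

End Ideals.

(* Right A-modules are left modules over the converse ring A^c. *)
Definition right_primitive (A : nzRingType) (P : set A) : Prop :=
  @left_primitive A^c P.

Section Conductors.
Variables (T : nzRingType) (R : subringClosed T).

(* (R:T), (R:T)_l and (R:T)_r; since R is closed under addition, it does not
   matter whether TxT means the set of products or its additive span. *)
Definition cond : set T := [set x | forall s t, s * x * t \in R].
Definition condl : set T := [set x | forall t, t * x \in R].
Definition condr : set T := [set x | forall t, x * t \in R].

(* A subset of T contained in R, seen as a subset of the ring R. *)
Definition in_subring (X : set T) : set (subring R) := [set r | X (\val r)].

(* X is a finitely generated left (resp. right) R-submodule of T. *)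
Definition fg_left (X : set T) : Prop :=
  exists (n : nat) (x : 'I_n -> T),
    X = [set \sum_(i < n) \val (a i) * x i | a in [set: 'I_n -> subring R]].
Definition fg_right (X : set T) : Prop :=
  exists (n : nat) (x : 'I_n -> T),
    X = [set \sum_(i < n) x i * \val (a i) | a in [set: 'I_n -> subring R]].

End Conductors.

Arguments in_subring {T} R X _.

(* Main.v *)
Require Import Defs.
From HB Require Import structures.
From mathcomp Require Import all_boot all_order all_algebra.
From mathcomp Require Import boolp classical_sets.

(** Write [M], [L], [P] for the conductors [(R:T)], [(R:T)_l], [(R:T)_r], and
    assume that [M] is a maximal ideal of [T] with [M < L] and [M < P].

    The ideals [L * T] and [T * P] of [T] strictly contain [M], so both are
    [T] ([condlT], [Tcondr]). From [1 = sum of l i * t i] with [l i] in [L]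
    one gets [t = sum of (t * l i) * t i] for every [t] in [T], and
    [x = sum of l i * (t i * x)] for every [x] in [L]. As [T * L <= L <= R],
    the [t i] generate [T] as a left [R]-module and the [l i] generate [L] as a
    right [R]-module; the left annihilator of [L] is then that of the [l i].
    The equality [T * P = T] gives the mirror statements.

    For primitivity, [T] is a finitely generated right [R]-module, so [R] lies
    in a maximal right [R]-submodule [N] of [T], and [T / N] is simple. Its
    annihilator contains [L] because [T * L <= R <= N]. The converse rests on
    the maximality of [R]: for an [R]-bimodule [K] closed under products,
    [R + K] is [R] or [T] ([maximal_subring_add]). With [K] the left
    annihilator of [P] modulo [M], this shows that [x * P <= M] forces [x] in
    [L] ([lann_condr_mod_cond]). So if [x] is not in [L], then [x * p] is not
    in [M] for some [p] in [P]; if moreover [T * x <= N], then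
    [T * x * p * T <= N], and the maximality of [M] yields [N = T], which is
    absurd.

    Finally, if [L = M] or [P = M], the same dichotomy for [R + K] shows that
    [M] is a prime ideal of [R] ([prime_cond_condl], [prime_cond_condr]); so
    both inclusions are strict as soon as [M] is not prime. *)

Import GRing.Theory.
Local Open Scope classical_set_scope.
Local Open Scope ring_scope.

(** * Maximal submodules and simple quotients *)

Section SimpleQuotient.
Variables (A : nzRingType) (V : lmodType A).

(** [W] is a submodule of [V]. *)
Definition submodule (W : set V) : Prop :=
  [/\ W 0, forall x y, W x -> W y -> W (x - y) & forall a x, W x -> W (a *: x)].

(** A proper submodule [W] over which [V] is finitely generated lies in a
    maximal submodule: the union of a chain of proper submodules is proper,
    since it cannot contain all the finitely many generators. *)
Lemma exists_maximal_submodule (W : set V) (n : nat) (g : 'I_n -> V) :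
  submodule W -> W <> setT ->
  (forall N, submodule N -> W `<=` N -> (forall i, N (g i)) -> N = setT) ->
  exists N, [/\ submodule N, W `<=` N, N <> setT &
    forall N', submodule N' -> N `<=` N' -> N' = N \/ N' = setT].
Proof.
move=> subW neqW gen.
(* The empty set is admitted because the empty chain has an empty union. *)
pose Q (N : set V) := N = set0 \/ [/\ submodule N, W `<=` N & N <> setT].
have [F FQ totF|N [QN maxN]] := @Zorn_bigcup V Q.
  have [[X0 FX0 [v0 X0v0]]|noX] := pselect (exists2 X, F X & exists v, X v);
    last first.
    left; apply/seteqP; split=> // v [X FX Xv]; apply: noX.
    by exists X => //; exists v.
  have FP X v : F X -> X v -> [/\ submodule X, W `<=` X & X <> setT].
    by move=> FX Xv; case: (FQ _ FX) => // X_0; rewrite X_0 in Xv.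
  have common x y : (\bigcup_(X in F) X) x -> (\bigcup_(X in F) X) y ->
      exists X, [/\ F X, X x & X y].
    case=> X FX Xx [Y FY Yy]; case: (totF _ _ FX FY) => XY.
      by exists Y; split=> //; apply: XY.
    by exists X; split=> //; apply: XY.
  have [[X00 _ _] WX0 _] := FP _ _ FX0 X0v0.
  have subU : submodule (\bigcup_(X in F) X).
    split; first by exists X0.
      move=> x y /common h /h [X [FX Xx Xy]]; exists X => //.
      by have [[_ XB _] _ _] := FP _ _ FX Xx; apply: XB.
    move=> a x [X FX Xx]; exists X => //.
    by have [[_ _ XZ] _ _] := FP _ _ FX Xx; apply: XZ.
  right; split=> [//|w Ww|UT]; first by exists X0 => //; apply: WX0.
  have all_gen m : (m <= n)%N ->
      exists2 X, F X /\ X 0 & forall i : 'I_n, (i < m)%N -> X (g i).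
    elim: m => [_|m IHm lt_mn]; first by exists X0.
    have [X [FX X0' Xg]] := IHm (ltnW lt_mn).
    have [Y FY Yg] : (\bigcup_(X in F) X) (g (Ordinal lt_mn)) by rewrite UT.
    have Y0' : Y 0 by have [[]] := FP _ _ FY Yg.
    case: (totF _ _ FX FY) => XY.
      exists Y => // i; rewrite ltnS leq_eqVlt => /orP[/eqP im|lt_im].
        by rewrite (_ : i = Ordinal lt_mn) //; apply: val_inj.
      by apply: XY; apply: Xg.
    exists X => // i; rewrite ltnS leq_eqVlt => /orP[/eqP im|lt_im].
      by rewrite (_ : i = Ordinal lt_mn) //; [apply: XY|apply: val_inj].
    exact: Xg.
  have [X [FX X0'] Xg] := all_gen n (leqnn n).
  have [subX WX neqX] := FP _ _ FX X0'.
  by apply: neqX; apply: gen => // i; apply: Xg.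
have W0 : W 0 by case: subW.
case: QN => [N0|[subN WN neqN]].
  exfalso; apply: (maxN W); last by right; split.
  by rewrite N0; split=> [v|/(_ _ W0)].
exists N; split=> // N' subN' NN'.
have [->|neqN'] := pselect (N' = setT); first by right.
have [->|neqNN'] := pselect (N' = N); first by left.
exfalso; apply: (maxN N'); last by right; split=> // w /WN /NN'.
by split=> // N'N; apply: neqNN'; apply/seteqP.
Qed.

Section Quotient.
Variables (N : zmodClosed V) (NZ : forall a x, x \in N -> a *: x \in N).

(** The quotient module [V / N]. The proof that [N] is stable under scaling is
    a parameter of the type, so that the scalar action can be attached to it. *)
Definition modquot of (forall a x, x \in N -> a *: x \in N) : Type :=
  Quotient.quot N.
HB.instance Definition _ := GRing.Zmodule.on (modquot NZ).

Definition modquot_pi (v : V) : modquot NZ := (\pi_(Quotient.quot N) v)%qT.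
Definition modquot_scale (a : A) (q : modquot NZ) : modquot NZ :=
  modquot_pi (a *: repr (q : Quotient.quot N)).

Lemma modquot_piP x y : modquot_pi x = modquot_pi y <-> x - y \in N.
Proof.
rewrite /modquot_pi Quotient.idealrBE.
by split=> [->|/eqP//].
Qed.

Lemma modquot_pi_surj q : exists v, q = modquot_pi v.
Proof. by exists (repr (q : Quotient.quot N)); rewrite /modquot_pi reprK. Qed.

Lemma modquot_piD x y : modquot_pi (x + y) = modquot_pi x + modquot_pi y.
Proof. by rewrite /modquot_pi [LHS]raddfD. Qed.

Lemma modquot_scaleE a v : modquot_scale a (modquot_pi v) = modquot_pi (a *: v).
Proof.
apply/modquot_piP; rewrite -scalerBr NZ //.
by apply/modquot_piP; rewrite /modquot_pi reprK.
Qed.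

Lemma modquot_scaleA a b q :
  modquot_scale a (modquot_scale b q) = modquot_scale (a * b) q.
Proof.
by have [v ->] := modquot_pi_surj q; rewrite !modquot_scaleE scalerA.
Qed.

Lemma modquot_scale1 : left_id 1 modquot_scale.
Proof.
by move=> q; have [v ->] := modquot_pi_surj q; rewrite modquot_scaleE scale1r.
Qed.

Lemma modquot_scaleDr : right_distributive modquot_scale +%R.
Proof.
move=> a q r; have [v ->] := modquot_pi_surj q.
have [w ->] := modquot_pi_surj r.
by rewrite -modquot_piD !modquot_scaleE scalerDr modquot_piD.
Qed.

Lemma modquot_scaleDl q : {morph modquot_scale^~ q : a b / a + b}.
Proof.
move=> a b; have [v ->] := modquot_pi_surj q.
by rewrite !modquot_scaleE scalerDl modquot_piD.
Qed.

HB.instance Definition _ := GRing.Zmodule_isLmodule.Build A (modquot NZ)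
  modquot_scaleA modquot_scale1 modquot_scaleDr modquot_scaleDl.

Lemma modquot_piZ a v : modquot_pi (a *: v) = a *: modquot_pi v.
Proof. by rewrite -modquot_scaleE. Qed.

Lemma modquot_pi_eq0 v : modquot_pi v = 0 <-> v \in N.
Proof.
have <- : modquot_pi 0 = 0 by rewrite /modquot_pi [LHS]raddf0.
by rewrite modquot_piP subr0.
Qed.

End Quotient.

Arguments modquot {N} NZ.
Arguments modquot_pi {N} NZ v.
Arguments modquot_pi_surj {N} NZ q.
Arguments modquot_piP {N NZ x y}.
Arguments modquot_pi_eq0 {N NZ v}.
Arguments modquot_piZ {N NZ}.

(** The quotient by a maximal submodule is simple, and its annihilator is
    the set of scalars that map [V] into that submodule. *)
Lemma left_primitive_quotient (N : set V) :
  submodule N -> N <> setT ->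
  (forall N', submodule N' -> N `<=` N' -> N' = N \/ N' = setT) ->
  left_primitive [set a : A | forall v, N (a *: v)].
Proof.
case=> N0 NB NZ neqN maxN.
have [S inS] : exists S : zmodClosed V, forall v, v \in S <-> N v.
  have clN : zmod_closed (fun v => `[< N v >]).
    split; first exact/asboolP.
    by move=> x y /asboolP Nx /asboolP Ny; apply/asboolP/NB.
  pose clS := GRing.isZmodClosed.Build V (fun v => `[< N v >]) clN.
  pose S : zmodClosed V := HB.pack (fun v => `[< N v >]) clS.
  by exists S => v; split=> /asboolP.
have SZ a x : x \in S -> a *: x \in S by move=> /inS Nx; apply/inS/NZ.
exists (modquot SZ); split.
  split.
    have [v nNv] : exists v, ~ N v.
      apply: contrapT => NT; apply: neqN; apply/seteqP; split=> // v _.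
      by apply: contrapT => nNv; apply: NT; exists v.
    by exists (modquot_pi SZ v); apply/eqP => /modquot_pi_eq0/inS.
  move=> W.
  have [|v Nv|WN|WT] := maxN [set v | modquot_pi SZ v \in W].
  - split=> /= [|x y Wx Wy|a x Wx].
    + by rewrite (_ : modquot_pi SZ 0 = 0) ?rpred0 //; apply/modquot_pi_eq0/inS.
    + by rewrite -scaleN1r modquot_piD modquot_piZ rpredD // rpredZ.
    + by rewrite modquot_piZ rpredZ.
  - by rewrite /= (_ : modquot_pi SZ v = 0) ?rpred0 //; apply/modquot_pi_eq0/inS.
  - left; apply/seteqP; split=> q /=; last by move=> ->; rewrite rpred0.
    have [v ->] := modquot_pi_surj SZ q; move=> Wv.
    by apply/modquot_pi_eq0/inS; rewrite -WN.
  - right; apply/seteqP; split=> // q _.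
    have [v ->] := modquot_pi_surj SZ q.
    by have : [set: V] v by []; rewrite -WT.
apply/seteqP; split=> a /= aN.
  move=> q; have [v ->] := modquot_pi_surj SZ q.
  by rewrite -modquot_piZ; apply/modquot_pi_eq0/inS.
by move=> v; apply/inS/modquot_pi_eq0; rewrite modquot_piZ; apply: aN.
Qed.

End SimpleQuotient.

(** * The overring as a module over a subring *)

Section Restriction.
Variables (T : nzRingType) (R : subringClosed T).

(** [T] as a left [R]-module: a synonym of [T], indexed by [R] to carry the
    action of [R] by left multiplication. *)
Definition left_restr of subringClosed T : Type := T.
HB.instance Definition _ := GRing.Zmodule.copy (left_restr R) T.

Definition left_restr_scale (a : subring R) (t : left_restr R) : left_restr R :=
  \val a * (t : T).

Fact left_restr_scaleA a b t :
  left_restr_scale a (left_restr_scale b t) = left_restr_scale (a * b) t.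
Proof. exact: mulrA. Qed.

Fact left_restr_scale1 : left_id 1 left_restr_scale.
Proof. exact: mul1r. Qed.

Fact left_restr_scaleDr : right_distributive left_restr_scale +%R.
Proof. by move=> a t u; apply: mulrDr. Qed.

Fact left_restr_scaleDl t : {morph left_restr_scale^~ t : a b / a + b}.
Proof. by move=> a b; apply: mulrDl. Qed.

HB.instance Definition _ := GRing.Zmodule_isLmodule.Build (subring R)
  (left_restr R) left_restr_scaleA left_restr_scale1 left_restr_scaleDr
  left_restr_scaleDl.

(** [T] as a right [R]-module, i.e. as a left module over the converse ring. *)
Definition right_restr of subringClosed T : Type := T.
HB.instance Definition _ := GRing.Zmodule.copy (right_restr R) T.

Definition right_restr_scale (a : (subring R)^c) (t : right_restr R) :
  right_restr R := (t : T) * \val (a : subring R).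

Fact right_restr_scaleA a b t :
  right_restr_scale a (right_restr_scale b t) = right_restr_scale (a * b) t.
Proof. by symmetry; apply: mulrA. Qed.

Fact right_restr_scale1 : left_id 1 right_restr_scale.
Proof. exact: mulr1. Qed.

Fact right_restr_scaleDr : right_distributive right_restr_scale +%R.
Proof. by move=> a t u; apply: mulrDl. Qed.

Fact right_restr_scaleDl t : {morph right_restr_scale^~ t : a b / a + b}.
Proof. by move=> a b; apply: mulrDr. Qed.

HB.instance Definition _ := GRing.Zmodule_isLmodule.Build (subring R)^c
  (right_restr R) right_restr_scaleA right_restr_scale1 right_restr_scaleDr
  right_restr_scaleDl.

(** If [T] is finitely generated as a left module over the proper subring [R],
    then [R] lies in a maximal left [R]-submodule [N] of [T], and the elements
    of [R] that annihilate [T / N] form a left primitive ideal. *)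
Lemma left_primitive_restr :
  [set` R] <> [set: T] -> fg_left R setT ->
  exists N : set T, [/\ [set` R] `<=` N, N <> setT,
    forall x y, N x -> N y -> N (x - y),
    forall r x, r \in R -> N x -> N (r * x) &
    left_primitive [set a : subring R | forall t, N (\val a * t)]].
Proof.
move=> properR [n [g genT]].
have [||M [M0 MB MZ] RM Mg|N [subN RN neqN maxN]] :=
    @exists_maximal_submodule _ (left_restr R) [set` R] n g.
- split=> /= [|x y|a x]; [exact: rpred0|exact: rpredB|].
  by apply: rpredM; case: a.
- by [].
- apply/seteqP; split=> // t _.
  have : [set: T] t by [].
  rewrite genT => -[a _ <-].
  have MD x y : M x -> M y -> M (x + y).
    by move=> Mx My; rewrite -[y]opprK -[- y]sub0r; apply/MB/MB.
  by elim/big_ind: _ => // i _; apply: MZ.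
have [N0 NB NZ] := subN; exists N; split=> //.
  by move=> r x rR; apply: (NZ (Subring rR)).
exact: (@left_primitive_quotient _ _ N subN neqN maxN).
Qed.

Lemma right_primitive_restr :
  [set` R] <> [set: T] -> fg_right R setT ->
  exists N : set T, [/\ [set` R] `<=` N, N <> setT,
    forall x y, N x -> N y -> N (x - y),
    forall r x, r \in R -> N x -> N (x * r) &
    right_primitive [set a : subring R | forall t, N (t * \val a)]].
Proof.
move=> properR [n [g genT]].
have [||M [M0 MB MZ] RM Mg|N [subN RN neqN maxN]] :=
    @exists_maximal_submodule _ (right_restr R) [set` R] n g.
- split=> /= [|x y|a x]; [exact: rpred0|exact: rpredB|].
  by move=> xR; apply: rpredM => //; case: a.
- by [].
- apply/seteqP; split=> // t _.
  have : [set: T] t by [].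
  rewrite genT => -[a _ <-].
  have MD x y : M x -> M y -> M (x + y).
    by move=> Mx My; rewrite -[y]opprK -[- y]sub0r; apply/MB/MB.
  by elim/big_ind: _ => // i _; apply: MZ.
have [N0 NB NZ] := subN; exists N; split=> //.
  by move=> r x rR; apply: (NZ (Subring rR)).
exact: (@left_primitive_quotient _ _ N subN neqN maxN).
Qed.

End Restriction.

(** * Conductors of a maximal subring *)

(** [X * Y]: the finite sums of products of an element of [X] with an element
    of [Y]. *)
Definition product_set (T : nzRingType) (X Y : set T) : set T :=
  [set z | exists n (x y : 'I_n -> T),
    [/\ forall i, X (x i), forall i, Y (y i) & z = \sum_i x i * y i]].

Lemma product_set_ideal (T : nzRingType) (X Y : set T) :
  (forall t x, X x -> X (t * x)) -> (forall t y, Y y -> Y (y * t)) ->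
  two_sided_ideal (product_set T X Y).
Proof.
move=> TX YT; split.
- by exists 0, (fun=> 0), (fun=> 0); split=> [[]|[]|] //; rewrite big_ord0.
- move=> _ _ [n [x [y [Xx Yy ->]]]] [m [x' [y' [Xx' Yy' ->]]]].
  pose f i := match split i with inl j => x j | inr j => - x' j end.
  pose g i := match split i with inl j => y j | inr j => y' j end.
  exists (n + m)%N, f, g; split.
  + by move=> i; rewrite /f; case: split => j //; rewrite -mulN1r; apply: TX.
  + by move=> i; rewrite /g; case: split.
  + rewrite big_split_ord /=; congr (_ + _).
      by apply: eq_bigr => i _; rewrite /f /g (unsplitK (inl i)).
    rewrite -sumrN; apply: eq_bigr => i _.
    by rewrite /f /g (unsplitK (inr i)) mulNr.
- move=> a _ [n [x [y [Xx Yy ->]]]]; exists n, (fun i => a * x i), y.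
  split=> // [i|]; first exact: TX.
  by rewrite mulr_sumr; apply: eq_bigr => i _; rewrite mulrA.
- move=> a _ [n [x [y [Xx Yy ->]]]]; exists n, x, (fun i => y i * a).
  split=> // [i|]; first exact: YT.
  by rewrite mulr_suml; apply: eq_bigr => i _; rewrite mulrA.
Qed.

Section MaximalSubring.
Variables (T : nzRingType) (R : subringClosed T).
Hypothesis maxR : maximal_subring R.

Local Notation M := (cond R).
Local Notation L := (condl R).
Local Notation P := (condr R).

Lemma condl_sub x : L x -> x \in R.
Proof. by move=> /(_ 1); rewrite mul1r. Qed.

Lemma condr_sub x : P x -> x \in R.
Proof. by move=> /(_ 1); rewrite mulr1. Qed.

Lemma condl_mull t x : L x -> L (t * x).
Proof. by move=> Lx s; rewrite mulrA. Qed.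

Lemma condr_mulr t x : P x -> P (x * t).
Proof. by move=> Px s; rewrite -mulrA. Qed.

Lemma condl_mulr r x : r \in R -> L x -> L (x * r).
Proof. by move=> rR Lx s; rewrite mulrA rpredM. Qed.

Lemma condr_mull r x : r \in R -> P x -> P (r * x).
Proof. by move=> rR Px s; rewrite -mulrA rpredM. Qed.

Lemma condlB x y : L x -> L y -> L (x - y).
Proof. by move=> Lx Ly t; rewrite mulrBr rpredB. Qed.

Lemma condrB x y : P x -> P y -> P (x - y).
Proof. by move=> Px Py t; rewrite mulrBl rpredB. Qed.

Lemma cond_ideal : two_sided_ideal M.
Proof.
split=> [s t|x y Mx My s t|a x Mx s t|a x Mx s t].
- by rewrite mulr0 mul0r rpred0.
- by rewrite mulrBr mulrBl rpredB.
- by rewrite mulrA.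
- by rewrite -!mulrA mulrA.
Qed.

Lemma cond_sub_condl : M `<=` L.
Proof. by move=> x Mx t; rewrite -[_ * _]mulr1. Qed.

Lemma cond_sub_condr : M `<=` P.
Proof. by move=> x Mx t; rewrite -[x]mul1r. Qed.

Lemma condl_ideal_sub : two_sided_ideal L -> L `<=` M.
Proof. by move=> [_ _ _ LT] x Lx s t; rewrite -mulrA; apply: LT. Qed.

Lemma condr_ideal_sub : two_sided_ideal P -> P `<=` M.
Proof. by move=> [_ _ TP _] x Px s t; apply: TP. Qed.

Lemma cond_proper_condlP : M `<` L <-> ~ two_sided_ideal L.
Proof.
split=> [[_ nLM] /condl_ideal_sub //|nidL]; split; first exact: cond_sub_condl.
move=> LM; apply: nidL; suff -> : L = M by exact: cond_ideal.
by apply/seteqP; split=> //; apply: cond_sub_condl.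
Qed.

Lemma cond_proper_condrP : M `<` P <-> ~ two_sided_ideal P.
Proof.
split=> [[_ nPM] /condr_ideal_sub //|nidP]; split; first exact: cond_sub_condr.
move=> PM; apply: nidP; suff -> : P = M by exact: cond_ideal.
by apply/seteqP; split=> //; apply: cond_sub_condr.
Qed.

Lemma subring_neqT : [set` R] <> [set: T].
Proof. by case: maxR => -[_ nTR] _ RT; apply: nTR; rewrite RT. Qed.

(** For an [R]-bimodule [K] that is also closed under multiplication, [R + K]
    is a subring, hence equal to [R] or to [T]. *)
Lemma maximal_subring_add (K : set T) :
  K 0 -> (forall x y, K x -> K y -> K (x - y)) ->
  (forall r x, r \in R -> K x -> K (r * x)) ->
  (forall r x, r \in R -> K x -> K (x * r)) ->
  (forall x y, K x -> K y -> K (x * y)) ->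
  K `<=` [set` R] \/ forall t, exists r k, [/\ r \in R, K k & t = r + k].
Proof.
move=> K0 KB RK KR KK.
pose Q t := exists r k, [/\ r \in R, K k & t = r + k].
have KN x : K x -> K (- x) by move=> Kx; rewrite -sub0r; apply: KB.
have KD x y : K x -> K y -> K (x + y).
  by move=> Kx Ky; rewrite -[y]opprK; apply/KB/KN.
have clQ : subring_closed (fun t => `[< Q t >]).
  split.
  - by apply/asboolP; exists 1, 0; rewrite rpred1 addr0.
  - move=> _ _ /asboolP[r [k [rR Kk ->]]] /asboolP[r' [k' [rR' Kk' ->]]].
    apply/asboolP; exists (r - r'), (k - k'); split; first exact: rpredB.
      exact: KB.
    by rewrite opprD addrACA.
  - move=> _ _ /asboolP[r [k [rR Kk ->]]] /asboolP[r' [k' [rR' Kk' ->]]].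
    apply/asboolP; exists (r * r'), (r * k' + k * r' + k * k').
    split; first exact: rpredM.
      by apply: (KD); [apply: KD; [apply: RK|apply: KR]|apply: KK].
    by rewrite mulrDl !mulrDr !addrA.
pose clS := GRing.isSubringClosed.Build T (fun t => `[< Q t >]) clQ.
pose S : subringClosed T := HB.pack (fun t => `[< Q t >]) clS.
have [KR'|nKR] := pselect (K `<=` [set` R]); [by left|right=> t].
apply: contrapT => nQt; case: maxR => _; apply; exists S; split.
  split=> [r rR|SR].
    by apply/asboolP; exists r, 0; rewrite addr0.
  apply: nKR => k Kk; apply: SR; apply/asboolP; exists 0, k.
  by rewrite rpred0 add0r.
by split=> // TS; have /asboolP := TS t I.
Qed.

(** If the largest left ideal of [T] inside [R] is the conductor, then the
    conductor is a prime ideal of [R]. Indeed, let [I * J <= M] for ideals of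
    [R], and let [H] be the left ideal of all [t] with [t * J <= M]. Either
    [H <= R], and then [I <= H <= L], or [T = R + H], and then
    [T * J <= R], so that [J <= L]. *)
Lemma prime_cond_condl : L `<=` M -> prime_ideal (in_subring R M).
Proof.
move=> LM; have [M0 MB TM MT] := cond_ideal; split.
- split=> [|x y Mx My|a x Mx|a x Mx]; [exact: M0|exact: MB|exact: TM|exact: MT].
- split=> // TM'; apply: subring_neqT; apply/seteqP; split=> // t _.
  have M1 : M 1 by apply: (TM' 1).
  by have := M1 1 t; rewrite !mul1r.
move=> I J idI [J0 JB RJ JR] IJ.
pose H := [set t | forall y, J y -> M (t * \val y)].
have HB x y : H x -> H y -> H (x - y).
  by move=> Hx Hy j Jj; rewrite mulrBl; apply: MB; [apply: Hx|apply: Hy].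
have TH t x : H x -> H (t * x).
  by move=> Hx j Jj; rewrite -mulrA; apply/TM/Hx.
have HR r x : r \in R -> H x -> H (x * r).
  by move=> rR Hx j Jj; rewrite -mulrA; apply: (Hx (Subring rR * j)); apply: RJ.
have H0 : H 0 by move=> j Jj; rewrite mul0r.
case: (maximal_subring_add H H0 HB).
- by move=> r x _; apply: TH.
- exact: HR.
- by move=> x y _; apply: TH.
- move=> HsubR; left=> x Ix; apply: LM => t; apply: HsubR.
  by apply: TH => y Jy; apply: IJ.
- move=> TRH; right=> y Jy; apply: LM => t.
  have [r [h [rR Hh ->]]] := TRH t.
  rewrite mulrDl; apply: rpredD; first by rewrite rpredM //; case: (y).
  exact: condl_sub (cond_sub_condl _ (Hh _ Jy)).
Qed.

(** The mirror image of [prime_cond_condl]. *)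
Lemma prime_cond_condr : P `<=` M -> prime_ideal (in_subring R M).
Proof.
move=> PM; have [M0 MB TM MT] := cond_ideal; split.
- split=> [|x y Mx My|a x Mx|a x Mx]; [exact: M0|exact: MB|exact: TM|exact: MT].
- split=> // TM'; apply: subring_neqT; apply/seteqP; split=> // t _.
  have M1 : M 1 by apply: (TM' 1).
  by have := M1 1 t; rewrite !mul1r.
move=> I J [I0 IB RI IR] idJ IJ.
pose H := [set t | forall x, I x -> M (\val x * t)].
have HB x y : H x -> H y -> H (x - y).
  by move=> Hx Hy i Ii; rewrite mulrBr; apply: MB; [apply: Hx|apply: Hy].
have HT t x : H x -> H (x * t).
  by move=> Hx i Ii; rewrite mulrA; apply/MT/Hx.
have RH r x : r \in R -> H x -> H (r * x).
  by move=> rR Hx i Ii; rewrite mulrA; apply: (Hx (i * Subring rR)); apply: IR.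
have H0 : H 0 by move=> i Ii; rewrite mulr0.
case: (maximal_subring_add H H0 HB).
- exact: RH.
- by move=> r x _; apply: HT.
- by move=> x y Hx _; apply: HT.
- move=> HsubR; right=> y Jy; apply: PM => t; apply: HsubR.
  by apply: HT => x Ix; apply: IJ.
- move=> TRH; left=> x Ix; apply: PM => t.
  have [r [h [rR Hh ->]]] := TRH t.
  rewrite mulrDr; apply: rpredD; first by rewrite rpredM //; case: (x).
  exact: condl_sub (cond_sub_condl _ (Hh _ Ix)).
Qed.

Section MaximalConductor.
Hypothesis maxM : maximal_ideal M.
Hypotheses (ltML : M `<` L) (ltMP : M `<` P).

Lemma condlT : product_set T L setT = setT.
Proof.
have LLT x : L x -> product_set T L setT x.
  move=> Lx; exists 1, (fun=> x), (fun=> 1).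
  by split=> //; rewrite big_ord1 mulr1.
case: maxM => _ _ /(_ (product_set T L setT)); case=> // [|x Mx|LTM].
- by apply: product_set_ideal => // t x; apply: condl_mull.
- exact/LLT/cond_sub_condl.
- by case: ltML => _; case=> x /LLT; rewrite LTM.
Qed.

Lemma Tcondr : product_set T setT P = setT.
Proof.
have PTP x : P x -> product_set T setT P x.
  move=> Px; exists 1, (fun=> 1), (fun=> x).
  by split=> //; rewrite big_ord1 mul1r.
case: maxM => _ _ /(_ (product_set T setT P)); case=> // [|x Mx|TPM].
- by apply: product_set_ideal => // t x; apply: condr_mulr.
- exact/PTP/cond_sub_condr.
- by case: ltMP => _; case=> x /PTP; rewrite TPM.
Qed.

(** Writing [1] as a sum of [l i * t i] with [l i] in [L], the [t i] generate
    [T] as a left [R]-module and the [l i] generate [L] as a right one. *)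
Lemma fg_left_overring : fg_left R setT.
Proof.
have [n [l [u [Ll _ e1]]]] : product_set T L setT 1 by rewrite condlT.
exists n, u.
apply/seteqP; split=> // t _.
exists (fun i => Subring (condl_sub _ (condl_mull t _ (Ll i)))) => //.
rewrite -[RHS]mulr1 e1 mulr_sumr; apply: eq_bigr => i _.
by rewrite mulrA.
Qed.

Lemma fg_right_overring : fg_right R setT.
Proof.
have [n [u [p [_ Pp e1]]]] : product_set T setT P 1 by rewrite Tcondr.
exists n, u.
apply/seteqP; split=> // t _.
exists (fun i => Subring (condr_sub _ (condr_mulr t _ (Pp i)))) => //.
rewrite -[RHS]mul1r e1 mulr_suml; apply: eq_bigr => i _.
by rewrite mulrA.
Qed.

Lemma condl_generators : exists n (l : 'I_n -> T), (forall i, L (l i)) /\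
  L = [set \sum_i l i * \val (a i) | a in [set: 'I_n -> subring R]].
Proof.
have [n [l [u [Ll _ e1]]]] : product_set T L setT 1 by rewrite condlT.
exists n, l; split=> //.
apply/seteqP; split=> [x Lx|_ [a _ <-]].
  exists (fun i => Subring (condl_sub _ (condl_mull (u i) _ Lx))) => //.
  rewrite -[RHS]mul1r e1 mulr_suml; apply: eq_bigr => i _.
  by rewrite mulrA.
move=> t; rewrite mulr_sumr rpred_sum // => i _.
by rewrite mulrA rpredM //; [apply: Ll|case: (a i)].
Qed.

Lemma condr_generators : exists n (p : 'I_n -> T), (forall i, P (p i)) /\
  P = [set \sum_i \val (a i) * p i | a in [set: 'I_n -> subring R]].
Proof.
have [n [u [p [_ Pp e1]]]] : product_set T setT P 1 by rewrite Tcondr.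
exists n, p; split=> //.
apply/seteqP; split=> [x Px|_ [a _ <-]].
  exists (fun i => Subring (condr_sub _ (condr_mulr (u i) _ Px))) => //.
  rewrite -[RHS]mulr1 e1 mulr_sumr; apply: eq_bigr => i _.
  by rewrite mulrA.
move=> t; rewrite mulr_suml rpred_sum // => i _.
by rewrite -mulrA rpredM //; [case: (a i)|apply: Pp].
Qed.

(** The left annihilator of [P] modulo [M] is a left ideal that is stable
    under right multiplication by [R]. It cannot complement [R] in [T], since
    [P] would then be an ideal of [T]; so it lies in [R], hence in [L]. *)
Lemma lann_condr_mod_cond x : (forall p, P p -> M (x * p)) -> L x.
Proof.
have [M0 MB TM MT] := cond_ideal.
pose H := [set t | forall p, P p -> M (t * p)].
have HB y z : H y -> H z -> H (y - z).
  by move=> Hy Hz p Pp; rewrite mulrBl; apply: MB; [apply: Hy|apply: Hz].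
have TH t y : H y -> H (t * y).
  by move=> Hy p Pp; rewrite -mulrA; apply/TM/Hy.
have HR r y : r \in R -> H y -> H (y * r).
  by move=> rR Hy p Pp; rewrite -mulrA; apply/Hy/condr_mull.
have H0 : H 0 by move=> p Pp; rewrite mul0r.
move=> Hx; case: (maximal_subring_add H H0 HB).
- by move=> r y _; apply: TH.
- exact: HR.
- by move=> y z _; apply: TH.
- by move=> HsubR t; apply: HsubR; apply: TH.
- move=> TRH; case: (cond_proper_condrP.1 ltMP); split.
  + exact: cond_sub_condr.
  + exact: condrB.
  + move=> t p Pp s; have [r [h [rR Hh ->]]] := TRH t.
    rewrite -mulrA mulrDl rpredD //; first by rewrite rpredM.
    rewrite mulrA; apply: condr_sub; apply: condr_mulr.
    exact/cond_sub_condr/Hh.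
  + by move=> t p; apply: condr_mulr.
Qed.

(** The mirror image of [lann_condr_mod_cond]. *)
Lemma rann_condl_mod_cond x : (forall l, L l -> M (l * x)) -> P x.
Proof.
have [M0 MB TM MT] := cond_ideal.
pose H := [set t | forall l, L l -> M (l * t)].
have HB y z : H y -> H z -> H (y - z).
  by move=> Hy Hz l Ll; rewrite mulrBr; apply: MB; [apply: Hy|apply: Hz].
have HT t y : H y -> H (y * t).
  by move=> Hy l Ll; rewrite mulrA; apply/MT/Hy.
have RH r y : r \in R -> H y -> H (r * y).
  by move=> rR Hy l Ll; rewrite mulrA; apply/Hy/condl_mulr.
have H0 : H 0 by move=> l Ll; rewrite mulr0.
move=> Hx; case: (maximal_subring_add H H0 HB).
- exact: RH.
- by move=> r y _; apply: HT.
- by move=> y z Hy _; apply: HT.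
- by move=> HsubR t; apply: HsubR; apply: HT.
- move=> TRH; case: (cond_proper_condlP.1 ltML); split.
  + exact: cond_sub_condl.
  + exact: condlB.
  + by move=> t l; apply: condl_mull.
  + move=> t l Ll s; have [r [h [rR Hh ->]]] := TRH t.
    rewrite mulrA mulrDr rpredD //; first by rewrite rpredM.
    rewrite -mulrA; apply: condl_sub; apply: condl_mull.
    exact/cond_sub_condl/Hh.
Qed.

(** An additive subgroup of [T] that contains [M] together with all
    [s * z * t], for some [z] outside [M], is [T] by maximality of [M]. *)
Lemma subgroup_full (N : set T) z :
  (forall x y, N x -> N y -> N (x - y)) -> M `<=` N ->
  ~ M z -> (forall s t, N (s * z * t)) -> N = setT.
Proof.
move=> NB MN nMz Nz; have [M0 MB TM MT] := cond_ideal.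
case: maxM => _ _ /(_ [set x | forall s t, N (s * x * t)]); case.
- split=> [s t|x y Nx Ny s t|a x Nx s t|a x Nx s t].
  + by rewrite mulr0 mul0r; apply: MN.
  + by rewrite mulrBr mulrBl; apply: NB.
  + by rewrite mulrA.
  + by rewrite -!mulrA mulrA.
- by move=> x Mx s t; apply/MN/MT/TM.
- by move=> eqM; case: nMz; rewrite -eqM.
- move=> eqT; apply/seteqP; split=> // t _.
  have : [set: T] t by [].
  by rewrite -eqT => /(_ 1 1); rewrite mulr1 mul1r.
Qed.

(** [L] is the annihilator of a simple quotient [T / N] of the right
    [R]-module [T], where [N] contains [R]: if [T * x <= N] with [x] outside
    [L], then [x * p] is outside [M] for some [p] in [P], while
    [T * x * p * T <= N * P <= N]. *)
Lemma right_primitive_condl : right_primitive (in_subring R L).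
Proof.
have [N [RN neqN NB NR primN]] :=
  right_primitive_restr T R subring_neqT fg_right_overring.
have MN : M `<=` N by move=> x /cond_sub_condl/condl_sub; apply: RN.
suff <- : [set a : subring R | forall t, N (t * \val a)] = in_subring R L by [].
apply/seteqP; split=> x Nx; last by move=> t; apply: RN; apply: Nx.
apply: contrapT => nLx.
have [p [Pp nMxp]] : exists p, P p /\ ~ M (\val x * p).
  apply: contrapT => np; apply: nLx; apply: lann_condr_mod_cond => p Pp.
  by apply: contrapT => nMxp; apply: np; exists p.
apply: neqN; apply: (subgroup_full N (\val x * p)) => // s t.
by rewrite mulrA -mulrA; apply: NR; [apply: Pp|apply: Nx].
Qed.

(** The mirror image of [right_primitive_condl]. *)
Lemma left_primitive_condr : left_primitive (in_subring R P).
Proof.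
have [N [RN neqN NB RN' primN]] :=
  left_primitive_restr T R subring_neqT fg_left_overring.
have MN : M `<=` N by move=> x /cond_sub_condl/condl_sub; apply: RN.
suff <- : [set a : subring R | forall t, N (\val a * t)] = in_subring R P by [].
apply/seteqP; split=> x Nx; last by move=> t; apply: RN; apply: Nx.
apply: contrapT => nPx.
have [l [Ll nMlx]] : exists l, L l /\ ~ M (l * \val x).
  apply: contrapT => nl; apply: nPx; apply: rann_condl_mod_cond => l Ll.
  by apply: contrapT => nMlx; apply: nl; exists l.
apply: neqN; apply: (subgroup_full N (l * \val x)) => // s t.
by rewrite mulrA -mulrA; apply: RN'; [apply: Ll|apply: Nx].
Qed.

End MaximalConductor.

End MaximalSubring.

Theorem corollary4p2 (T : nzRingType) (R : subringClosed T)
    (maxR : maximal_subring R) (maxM : maximal_ideal (cond R)) :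
  let conclusions :=
    [/\ (* (1) *) fg_left R setT /\ fg_right R setT,
        (* (2) *) [/\ fg_right R (condl R),
          right_primitive (in_subring R (condl R)) &
          exists (m : nat) (p : 'I_m -> T), (forall i, condl R (p i)) /\
            lann (condl R) = \bigcap_(i in [set: 'I_m]) lann [set p i]] &
        (* (3) *) [/\ fg_left R (condr R),
          left_primitive (in_subring R (condr R)) &
          exists (n : nat) (q : 'I_n -> T), (forall i, condr R (q i)) /\
            rann (condr R) = \bigcap_(i in [set: 'I_n]) rann [set q i]]] in
  [/\ (cond R `<` condl R) <-> ~ two_sided_ideal (condl R),
      (cond R `<` condr R) <-> ~ two_sided_ideal (condr R),
      cond R `<` condl R -> cond R `<` condr R -> conclusions &
      ~ prime_ideal (in_subring R (cond R)) -> conclusions].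
Proof.
move=> conclusions.
have concl : cond R `<` condl R -> cond R `<` condr R -> conclusions.
  move=> ltML ltMP; split.
  - by split; [apply: fg_left_overring|apply: fg_right_overring].
  - have [n [l [Ll eqL]]] := condl_generators T R maxM ltML.
    split; [by exists n, l|exact: right_primitive_condl|].
    exists n, l; split=> //; apply/seteqP; split=> t /= tL.
      by move=> i _ x /= ->; apply/tL/Ll.
    move=> x; rewrite eqL => -[a _ <-]; rewrite mulr_sumr big1 // => i _.
    by rewrite mulrA (tL i) ?mul0r.
  - have [n [p [Pp eqP]]] := condr_generators T R maxM ltMP.
    split; [by exists n, p|exact: left_primitive_condr|].
    exists n, p; split=> //; apply/seteqP; split=> t /= tP.
      by move=> i _ x /= ->; apply/tP/Pp.
    move=> x; rewrite eqP => -[a _ <-]; rewrite mulr_suml big1 // => i _.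
    by rewrite -mulrA (tP i) ?mulr0.
split=> //; [exact: cond_proper_condlP|exact: cond_proper_condrP|].
move=> nprime; apply: concl; split.
- exact: cond_sub_condl.
- by move=> LM; apply/nprime/prime_cond_condl.
- exact: cond_sub_condr.
- by move=> PM; apply/nprime/prime_cond_condr.
Qed.
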